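(* Let $d\ge 3$ be an integer and let $X$ be a real normed space with $\dim X\ge d$ (possibly infinite-dimensional). Then $X$ satisfies property (SRS$d$), i.e. every set of $d+1$ affine independent points of $X$ resolves its convex hull, if and only if $X$ is an inner product space (that is, its norm is induced by an inner product).
   Context: Let $X$ be a real normed space with norm $\|\cdot\|$ and let $R,S\subseteq X$. We say that $R$ resolves $S$ (or $R$ is a resolving set for $S$) if for any $s_1,s_2\in S$, the equations $\|r-s_1\|=\|r-s_2\|$ for all $r\in R$ imply $s_1=s_2$. For $d\in\mathbb{N}$, $d\ge 2$, a normed space $X$ with $\dim X\ge d$ has property (SRS$d$) if every set of $d+1$ affine independent points of $X$ resolves its convex hull. *)

(* Defs.v *)
From mathcomp Require Import all_boot all_order all_algebra sesquilinear.
From mathcomp Require Import all_classical all_reals all_analysis.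
Set Implicit Arguments.
Unset Strict Implicit.
Unset Printing Implicit Defensive.
Import Order.TTheory GRing.Theory Num.Theory.
Import numFieldNormedType.Exports.
Local Open Scope classical_set_scope.
Local Open Scope ring_scope.

Definition linearly_independent (R : realType) (X : normedModType R) (n : nat)
    (e : 'I_n -> X) : Prop :=
  forall a : 'I_n -> R, \sum_(i < n) a i *: e i = 0 -> forall i, a i = 0.

Definition dim_ge (R : realType) (X : normedModType R) (n : nat) : Prop :=
  exists e : 'I_n -> X, linearly_independent e.

(* Affine independence of a family forces it to be injective, so a family
   indexed by 'I_n has exactly n points in its range. *)
Definition affinely_independent (R : realType) (X : normedModType R) (n : nat)
    (p : 'I_n -> X) : Prop :=
  forall a : 'I_n -> R,
    \sum_(i < n) a i = 0 -> \sum_(i < n) a i *: p i = 0 -> forall i, a i = 0.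

Definition convex_hull (R : realType) (X : normedModType R) (A : set X) :
    set X :=
  smallest (@convex_set R X) A.

Definition resolves (R : realType) (X : normedModType R) (A S : set X) : Prop :=
  forall s1 s2 : X, S s1 -> S s2 ->
    (forall r : X, A r -> `|r - s1| = `|r - s2|) -> s1 = s2.

Definition SRS (R : realType) (d : nat) (X : normedModType R) : Prop :=
  forall p : 'I_d.+1 -> X, affinely_independent p ->
    resolves (range p) (convex_hull (range p)).

Definition inner_product_space (R : realType) (X : normedModType R) : Prop :=
  exists f : {dot X for idfun}, forall x : X, `|x| = Num.sqrt (f x x).

(* Main.v *)
Require Import Defs.
From HB Require Import structures.
From mathcomp Require Import all_boot all_order all_algebra sesquilinear.
From mathcomp Require Import all_classical all_reals all_analysis.
From mathcomp Require Import ring lra.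

(** In an inner product space, two points s1, s2 that are equidistant from
    every vertex p i satisfy f (p i) (s1 - s2) = c for one constant c. This
    linear equation passes to the convex hull, hence holds at s1 and s2
    themselves, and subtracting gives f (s1 - s2) (s1 - s2) = 0.

    For the converse, the dimension is first lowered to 3: a simplex that
    violates the property can be enlarged by a vertex, because the bisector of
    s1 and s2 meets every line of direction s2 - s1 ([SRS_pred]).

    The heart is Birkhoff orthogonality, [birkhoff x y], which says that x is
    a shortest vector of the line x + R y. Seen from far away, the bisector of
    - x and x looks like the cone of all g with [birkhoff g x]: each such g is
    at distance at most |x| from it. So four vectors of this cone that sum to
    zero and span a space containing x can be blown up and moved onto the
    bisector, and give a tetrahedron around - x and x all of whose vertices
    are equidistant from them ([SRS_centered_simplex]). Under the resolving
    property the cone therefore contains no four vectors in general position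
    ([SRS3_general_position]). A fat cone would contain four, so every line of
    direction x has only one foot of the perpendicular
    ([birkhoff_foot_unique]); then the cone is the graph of a continuous
    function, and the absence of general position forces this graph to be flat
    ([SRS3_birkhoff_left_additive]): if p and q are orthogonal to x, so is
    p + q.

    Left additivity in dimension 3 implies that the space is Euclidean. If e
    is orthogonal to x, choose w so that e is orthogonal to the whole plane
    spanned by x and w. For every t the functions u |-> |u| and u |-> |u + t e|
    on that plane are then minimal at the same point of every line, which
    makes the second constant on the circles of the first
    ([unit_circle_equidistant]); in particular |x + e| = |- x + e|
    ([birkhoff_isosceles]). Thus orthogonal vectors define isometric
    reflections, exchanging x and y as soon as |x| = |y| ([norm_swap]). Let
    A x y be the coefficient such that y - (A x y) x is orthogonal to x. It is
    linear in y by left additivity, and A x y = A y x if |x| = |y| by the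
    exchange, so |x|^2 (A x y) is a symmetric bilinear form, and its quadratic
    form is |x|^2 ([left_add_inner_product]). *)

Set Implicit Arguments.
Unset Strict Implicit.
Unset Printing Implicit Defensive.
Import Order.TTheory GRing.Theory Num.Theory.
Import numFieldNormedType.Exports.
Local Open Scope classical_set_scope.
Local Open Scope ring_scope.

(** * Linear identities in a module *)

Section ModuleEquations.
Context {R : comNzRingType} {V : lmodType R}.

(** Reified linear combinations of vectors. They reduce an equation between
    vectors to one scalar equation for each atom, which [ring] or [field] can
    solve; the scalars themselves are not reified. *)
Inductive mexp :=
| MAtom of nat | MZero | MAdd of mexp & mexp | MOpp of mexp
| MScale of R & mexp.

Fixpoint meval (env : seq V) (e : mexp) : V :=
  match e with
  | MAtom k => nth 0 env k
  | MZero => 0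
  | MAdd e1 e2 => meval env e1 + meval env e2
  | MOpp e1 => - meval env e1
  | MScale a e1 => a *: meval env e1
  end.

Fixpoint mcoef (e : mexp) (n : nat) : R :=
  match e with
  (* [cbn] evaluates [eqn], but not [==], on numerals. *)
  | MAtom k => if eqn k n then 1 else 0
  | MZero => 0
  | MAdd e1 e2 => mcoef e1 n + mcoef e2 n
  | MOpp e1 => - mcoef e1 n
  | MScale a e1 => a * mcoef e1 n
  end.

Fixpoint meq (n : nat) (e1 e2 : mexp) : Prop :=
  if n is n'.+1 then mcoef e1 n' = mcoef e2 n' /\ meq n' e1 e2 else True.

Lemma mevalE env e :
  meval env e = \sum_(i < size env) mcoef e i *: nth 0 env i.
Proof.
elim: e => [k||e1 IH1 e2 IH2|e1 IH1|a e1 IH1] /=; rewrite ?IH1 ?IH2.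
- have [kn|nk] := ltnP k (size env).
    rewrite (bigD1 (Ordinal kn)) //= -[eqn k k]/(k == k) eqxx scale1r.
    rewrite big1 ?addr0//.
    move=> i ik; rewrite -[eqn k i]/(k == i) ifN ?scale0r//.
    by apply: contraNneq ik => ki; apply/eqP/val_inj.
  rewrite nth_default// big1// => i _.
  by rewrite -[eqn k i]/(k == i) gtn_eqF ?scale0r// (leq_trans (ltn_ord i)).
- by rewrite big1// => i _; rewrite scale0r.
- by rewrite -big_split; apply: eq_bigr => i _; rewrite scalerDl.
- by rewrite -sumrN; apply: eq_bigr => i _; rewrite scaleNr.
- by rewrite scaler_sumr; apply: eq_bigr => i _; rewrite scalerA.
Qed.

Lemma meval_eq env e1 e2 : meq (size env) e1 e2 -> meval env e1 = meval env e2.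
Proof.
rewrite !mevalE => e12; apply: eq_bigr => i _; congr (_ *: _).
move: (size env) e12 i => n; elim: n => [_ []//|n IH /= [en /IH e12] i].
have := ltn_ord i; rewrite ltnS leq_eqVlt => /orP[/eqP-> //|lin].
exact: (e12 (Ordinal lin)).
Qed.

End ModuleEquations.

Ltac mod_index v env :=
  lazymatch env with
  | cons v _ => constr:(O)
  | cons _ ?env' => let k := mod_index v env' in constr:(S k)
  end.

Ltac mod_atoms V t env :=
  lazymatch t with
  | @GRing.add _ ?a ?b => let env' := mod_atoms V a env in mod_atoms V b env'
  | @GRing.opp _ ?a => mod_atoms V a env
  | @GRing.scale _ _ _ ?a => mod_atoms V a env
  | @GRing.zero _ => env
  (* If t is not yet an atom, the failure of mod_index in the first branch
     leads to the second. *)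
  | _ => match env with
         | _ => let k := mod_index t env in env
         | _ => constr:(@cons V t env)
         end
  end.

Ltac mod_reify R V t env :=
  lazymatch t with
  | @GRing.add _ ?a ?b =>
      let e1 := mod_reify R V a env in let e2 := mod_reify R V b env in
      constr:(@MAdd R e1 e2)
  | @GRing.opp _ ?a => let e := mod_reify R V a env in constr:(@MOpp R e)
  | @GRing.scale _ _ ?c ?a =>
      let e := mod_reify R V a env in constr:(@MScale R c e)
  | @GRing.zero _ => constr:(@MZero R)
  | _ => let k := mod_index t env in constr:(@MAtom R k)
  end.

(** Leaves the equality of the coefficients of each atom, highest index
    first. *)
Ltac module_eq R V :=
  lazymatch goal with
  | |- ?lhs = ?rhs =>
    let env0 := mod_atoms V lhs (@nil V) in
    let env := mod_atoms V rhs env0 in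
    let e1 := mod_reify R V lhs env in
    let e2 := mod_reify R V rhs env in
    refine (@meval_eq R V env e1 e2 _);
    cbn [meq mcoef size eqn]; repeat split
  end.

(** On each piece of a subdivision into 2^n equal parts the bound is the
    length of the piece times the variation of m on it; these telescope to
    2^-n times the bound on the whole interval. The function m may jump, as
    does a subgradient of a norm. *)
Lemma constant_of_square_variation (R : realType) (psi m : R -> R) (C : R) :
  (forall s t, `|psi t - psi s| <= C * ((t - s) * (m t - m s))) ->
  forall s t, psi s = psi t.
Proof.
move=> H.
have step n : forall s t,
    `|psi t - psi s| * 2 ^+ n <= C * ((t - s) * (m t - m s)).
  elim: n => [|n IH] s t; first by rewrite expr0 mulr1.
  pose c := (s + t) / 2.
  have := IH s c; have := IH c t.
  have := ler_normD (psi t - psi c) (psi c - psi s).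
  rewrite addrA subrK exprS => h h1 h2.
  apply: le_trans
    (_ : 2 * ((`|psi t - psi c| + `|psi c - psi s|) * 2 ^+ n) <= _).
    by rewrite mulrCA ler_pM2l// ler_wpM2r// exprn_ge0.
  have -> : C * ((t - s) * (m t - m s)) =
    2 * (C * ((t - c) * (m t - m c)) + C * ((c - s) * (m c - m s))).
    by rewrite /c; field.
  by rewrite ler_pM2l// mulrDl lerD.
move=> s t; apply/eqP; rewrite eq_sym -subr_eq0 -normr_le0.
rewrite leNgt; apply/negP => d0; set e := `|_| in d0.
pose K := C * ((t - s) * (m t - m s)).
have [n nP] : exists n, K / e <= n%:R.
  by exists (Num.truncn (K / e)).+1; apply: ltW; exact: truncnS_gt.
have : K < 2 ^+ n * e.
  rewrite -ltr_pdivrMr//; apply: le_lt_trans nP _.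
  by rewrite -natrX ltr_nat ltn_expl.
by rewrite mulrC ltNge step.
Qed.

(** x is a point of least norm on the line through x of direction y. The
    relation is homogeneous, but in general neither symmetric nor additive in
    either argument. *)
Definition birkhoff (R : realType) (X : normedModType R) (x y : X) : Prop :=
  forall t : R, `|x| <= `|x + t *: y|.

Definition birkhoff_left_additive (R : realType) (X : normedModType R) : Prop :=
  forall p q x : X, birkhoff p x -> birkhoff q x -> birkhoff (p + q) x.

Section NormedSpace.
Context {R : realType} {X : normedModType R}.
Implicit Types (x y z p q u v w e : X) (a b c s t : R).
Local Notation "x _|_ y" := (birkhoff x y) (at level 70, no associativity).
Ltac vec := module_eq R X; try ring.

(** * Birkhoff orthogonality in an arbitrary normed space *)

Lemma birkhoffZ a b x y : x _|_ y -> a *: x _|_ b *: y.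
Proof.
move=> xy t; have [->|a0] := eqVneq a 0.
  by rewrite scale0r normr0.
have -> : a *: x + t *: (b *: y) = a *: (x + (a^-1 * t * b) *: y).
  by module_eq R X; field.
by rewrite !normrZ ler_wpM2l.
Qed.

Lemma birkhoffZl a x y : x _|_ y -> a *: x _|_ y.
Proof. by move=> /(birkhoffZ a 1); rewrite scale1r. Qed.

Lemma birkhoff_self a x : x != 0 -> a *: x _|_ x -> a = 0.
Proof.
move=> x0 /(_ (- a)); rewrite scaleNr subrr normr0 normr_le0 scaler_eq0.
by rewrite (negbTE x0) orbF => /eqP.
Qed.

Lemma continuous_norm_line y x : continuous (fun t : R => `|y + t *: x|).
Proof.
move=> t; apply: (@continuous_comp _ _ _ (fun t : R => y + t *: x) Num.norm).
  apply: cvgD; first exact: cvg_cst.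
  by apply: cvgZr_tmp; exact: cvg_id.
exact: norm_continuous.
Qed.

(** The norm tends to infinity along the line, so its minimum is attained on
    a segment; the half-length 2 |y| / |x| is enough because outside it the
    norm exceeds |y|, the value at 0. *)
Lemma birkhoff_foot y x : exists a, y + a *: x _|_ x.
Proof.
have [->|x0] := eqVneq x 0.
  by exists 0 => t; rewrite !scaler0 !addr0.
have nx : 0 < `|x| by rewrite normr_gt0.
pose M := 2 * `|y| / `|x|.
have M0 : 0 <= M by rewrite !mulr_ge0 ?invr_ge0.
have [||c _ cmin] := @EVT_min R (fun t => `|y + t *: x|) (- M) M.
- lra.
- by apply: continuous_subspaceT; exact: continuous_norm_line.
exists c => t; have -> : y + c *: x + t *: x = y + (c + t) *: x by vec.
have [tM|] := boolP (c + t \in `[- M, M]); first exact: cmin.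
rewrite in_itv /= -ler_norml -ltNge => tM.
have /cmin : 0 \in `[- M, M] by rewrite in_itv/=; apply/andP; split; lra.
rewrite scale0r addr0 => /le_trans; apply.
have := ler_normB (y + (c + t) *: x) y.
have -> : y + (c + t) *: x - y = (c + t) *: x by vec.
rewrite normrZ => h.
have : M * `|x| <= `|c + t| * `|x| by rewrite ler_pM2r// ltW.
rewrite /M divfK ?gt_eqF//; lra.
Qed.

(** A norming functional of x on the plane spanned by x and d, with m its
    value at d. The left slopes of t |-> |x + t d| at 0 stay below the right
    slopes by convexity, and m is the supremum of the left slopes; this settles
    a > 0 by homogeneity, and the triangle inequality then gives the rest. *)
Lemma norm_subgradient x d : exists m,
  forall a b, a * `|x| + b * m <= `|a *: x + b *: d|.
Proof.
pose S := [set (`|x| - `|x - s *: d|) / s | s in [set s : R | 0 < s]].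
have key s t : 0 < s -> 0 < t ->
    (`|x| - `|x - s *: d|) / s <= (`|x + t *: d| - `|x|) / t.
  move=> s0 t0; rewrite ler_pdivrMr// mulrAC ler_pdivlMr//.
  have := ler_normD (t *: (x - s *: d)) (s *: (x + t *: d)).
  have -> : t *: (x - s *: d) + s *: (x + t *: d) = (s + t) *: x by vec.
  rewrite !normrZ !gtr0_norm ?addr_gt0//; nra.
have ubS t : 0 < t -> ubound S ((`|x + t *: d| - `|x|) / t).
  by move=> t0 _ [s s0 <-]; exact: key.
have S0 : S !=set0 by exists ((`|x| - `|x - 1 *: d|) / 1), 1 => //=.
have supS : has_sup S.
  by split=> //; exists ((`|x + 1 *: d| - `|x|) / 1); exact: ubS.
pose m := sup S.
have pos b : `|x| + b * m <= `|x + b *: d|.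
  have [b0|b0|->] := ltgtP b 0; last by rewrite mul0r scale0r !addr0.
  - have Sb : S ((`|x| - `|x - (- b) *: d|) / (- b)).
      by exists (- b) => //=; rewrite oppr_gt0.
    have := ub_le_sup supS.2 Sb; rewrite -/m ler_pdivrMr ?oppr_gt0//.
    have -> : x - - b *: d = x + b *: d by vec.
    lra.
  - have := ge_sup S0 (ubS _ b0); rewrite -/m ler_pdivlMr//; lra.
exists m => a b.
have posa a' b' : 0 < a' -> a' * `|x| + b' * m <= `|a' *: x + b' *: d|.
  move=> a0; have := pos (b' / a').
  have -> : a' *: x + b' *: d = a' *: (x + (b' / a') *: d).
    by module_eq R X; field; rewrite gt_eqF.
  rewrite normrZ gtr0_norm// -(ler_pM2l a0) => h; apply: le_trans h.
  by rewrite le_eqVlt; apply/orP; left; apply/eqP; field; rewrite gt_eqF.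
(* Add (1 - a) x, which makes the coefficient of x equal to 1. *)
have [a0|a0] := ltP 0 a; first exact: posa.
have /posa : 0 < a + (1 - a) by lra.
move=> /(_ b).
have -> : (a + (1 - a)) *: x + b *: d = (a *: x + b *: d) + (1 - a) *: x by vec.
have := ler_normD (a *: x + b *: d) ((1 - a) *: x).
rewrite normrZ ger0_norm; lra.
Qed.

(** The vector w + a e is taken in the kernel of a norming functional of
    e. *)
Lemma birkhoff_right_exists e w : e != 0 -> exists a, e _|_ w + a *: e.
Proof.
move=> e0; have [m mP] := norm_subgradient e w.
have ne : 0 < `|e| by rewrite normr_gt0.
exists (- (m / `|e|)) => t.
have -> : e + t *: (w + - (m / `|e|) *: e) = (1 - t * (m / `|e|)) *: e + t *: w.
  by vec.
apply: le_trans (mP _ _).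
rewrite le_eqVlt; apply/orP; left; apply/eqP; field; lra.
Qed.

(** The cone orthogonal to x stays within |x| of the bisector of - x and x:
    the difference of the two distances changes sign between g - x and
    g + x. *)
Lemma bisector_near g x : g _|_ x ->
  exists2 t, `|t| <= 1 & `|g + t *: x - x| = `|g + t *: x + x|.
Proof.
move=> gx; pose f t := `|g + t *: x + x| - `|g + t *: x - x|.
have fE : f = (fun t => `|(g + x) + t *: x| - `|(g - x) + t *: x|).
  by apply/funext => t; rewrite /f; congr (_ - _); congr Num.norm; vec.
have [|||c] := @IVT R f (- 1) 1 0.
- lra.
- apply: continuous_subspaceT => t; rewrite fE.
  by apply: cvgB; exact: continuous_norm_line.
- have f1 : f (-1) <= 0.
    rewrite /f subr_le0.
    have -> : g + -1 *: x + x = g by vec.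
    have -> : g + -1 *: x - x = g + (-2) *: x by vec.
    exact: gx.
  have f2 : 0 <= f 1.
    rewrite /f subr_ge0.
    have -> : g + 1 *: x - x = g by vec.
    have -> : g + 1 *: x + x = g + 2 *: x by vec.
    exact: gx.
  by rewrite ge_min f1 le_max f2 orbT.
rewrite in_itv/= -ler_norml => c1 /eqP; rewrite subr_eq0 => /eqP fc.
by exists c.
Qed.

(** * Convex hulls and dimension *)

Lemma convex_setP (C : set X) :
  convex_set C <-> forall x y t, C x -> C y -> 0 <= t -> t <= 1 ->
                     C (t *: x + (1 - t) *: y).
Proof.
split=> [cC x y t Cx Cy t0 t1|cC x y l].
- have t01 : (0 <= t <= 1) by rewrite t0.
  have := cC x y (Itv01 t0 t1); rewrite !inE => /(_ Cx Cy); exact.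
- by rewrite !inE => Cx Cy; apply: cC.
Qed.

(** The sum of the weights is normalised inside the induction, since dropping
    a term changes it. *)
Lemma convex_set_sum (C : set X) n (p : 'I_n -> X) (l : 'I_n -> R) :
  convex_set C -> (forall i, C (p i)) -> (forall i, 0 <= l i) ->
  \sum_(i < n) l i = 1 -> C (\sum_(i < n) l i *: p i).
Proof.
move=> /convex_setP cC.
suff H : forall n (p : 'I_n -> X) (l : 'I_n -> R), (forall i, C (p i)) ->
    (forall i, 0 <= l i) -> 0 < \sum_(i < n) l i ->
    C ((\sum_(i < n) l i)^-1 *: \sum_(i < n) l i *: p i).
  move=> Cp l0 l1; have := H n p l Cp l0.
  by rewrite l1 invr1 scale1r; apply; exact: ltr01.
elim=> [|{}n IH] {}p {}l Cp l0; first by rewrite big_ord0 ltxx.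
rewrite !big_ord_recl; set s := \sum_(i < n) _; set v := \sum_(i < n) _ => s0.
have s'0 : 0 <= s by rewrite sumr_ge0.
have [s'E|s'N] := eqVneq s 0.
  have -> : v = 0.
    rewrite /v big1// => i _.
    have /psumr_eq0P := s'E; rewrite /= => /(_ (fun i _ => l0 _)) -> //.
    by rewrite scale0r.
  move: s0; rewrite s'E !addr0 => s0.
  by rewrite scalerA mulVf ?scale1r ?gt_eqF.
have sp : 0 < s by rewrite lt_neqAle eq_sym s'N.
have Cv : C (s^-1 *: v) by exact: (IH (fun i => p (lift ord0 i))).
have := cC _ _ (l ord0 / (l ord0 + s)) (Cp ord0) Cv.
have -> : (l ord0 / (l ord0 + s)) *: p ord0 +
   (1 - l ord0 / (l ord0 + s)) *: (s^-1 *: v) =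
   (l ord0 + s)^-1 *: (l ord0 *: p ord0 + v).
  by module_eq R X; field; rewrite ?gt_eqF.
apply; first by rewrite divr_ge0// ltW.
by rewrite ler_pdivrMr// mul1r lerDl.
Qed.

Lemma convex_hull_sub (A C : set X) :
  convex_set C -> A `<=` C -> convex_hull A `<=` C.
Proof. by move=> cC AC; exact: smallest_sub. Qed.

Lemma convex_hull_convex (A : set X) : convex_set (convex_hull A).
Proof.
apply/convex_setP => x y t hx hy t0 t1 C CA.
have /convex_setP cC := CA.1.
by apply: cC t0 t1; [exact: hx | exact: hy].
Qed.

Lemma sub_convex_hull (A : set X) : A `<=` convex_hull A.
Proof. exact: sub_gen_smallest. Qed.

Lemma convex_hull_sum n (p : 'I_n -> X) (l : 'I_n -> R) :
  (forall i, 0 <= l i) -> \sum_(i < n) l i = 1 ->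
  convex_hull (range p) (\sum_(i < n) l i *: p i).
Proof.
apply: convex_set_sum; first exact: convex_hull_convex.
by move=> i; apply: sub_convex_hull; exists i.
Qed.

(** The affine span of the points is a convex set containing them. *)
Lemma convex_hull_affine n (p : 'I_n -> X) x : convex_hull (range p) x ->
  exists2 l : 'I_n -> R, \sum_(i < n) l i = 1 & x = \sum_(i < n) l i *: p i.
Proof.
pose C := [set x | exists2 l : 'I_n -> R,
  \sum_(i < n) l i = 1 & x = \sum_(i < n) l i *: p i].
suff : convex_hull (range p) `<=` C by exact.
apply: convex_hull_sub.
  apply/convex_setP => {}x y t [l l1 ->] [k k1 ->] _ _.
  exists (fun i => t * l i + (1 - t) * k i).
    by rewrite big_split/= -!mulr_sumr l1 k1; ring.
  rewrite !scaler_sumr -big_split/=; apply: eq_bigr => i _.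
  by rewrite !scalerA -scalerDl.
move=> _ [i _ <-]; exists (fun j => (j == i)%:R).
  rewrite (bigD1 i)//= eqxx big1 ?addr0// => j ji.
  by rewrite (negbTE ji).
rewrite (bigD1 i)//= eqxx scale1r big1 ?addr0// => j ji.
by rewrite (negbTE ji) scale0r.
Qed.

Lemma dim_ge_not_span n (v : 'I_n -> X) : dim_ge X n.+1 ->
  exists y, forall c : 'I_n -> R, y <> \sum_(i < n) c i *: v i.
Proof.
move=> [e ind]; apply: contrapT => nex.
have /choice[A AP] : forall j, exists c : 'I_n -> R,
    e j = \sum_(i < n) c i *: v i.
  move=> j; apply: contrapT => nj.
  by apply: nex; exists (e j) => c ec; apply: nj; exists c.
pose M : 'M[R]_(n.+1, n) := \matrix_(j, i) A j i.
have : kermx M != 0.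
  by rewrite kermx_eq0 /row_free neq_ltn ltnS rank_leq_col.
move=> /rowV0Pn[u uker u0].
have uM : u *m M = 0 by apply/eqP; rewrite -sub_kermx.
suff uj j : u 0 j = 0.
  by move/eqP: u0; apply; apply/rowP => j; rewrite uj mxE.
move: j; apply: ind.
under eq_bigr do rewrite AP scaler_sumr.
rewrite exchange_big big1//= => i _.
under eq_bigr do rewrite scalerA.
rewrite -scaler_suml; have := congr1 (fun N : 'rV_n => N 0 i) uM.
rewrite !mxE; under eq_bigr do rewrite mxE.
by move=> ->; rewrite scale0r.
Qed.

Lemma dim_geS n : dim_ge X n.+1 -> dim_ge X n.
Proof.
move=> [e ind]; exists (fun i => e (lift ord0 i)) => a sa.
pose b (i : 'I_n.+1) : R := if unlift ord0 i is Some j then a j else 0.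
have bE i : b (lift ord0 i) = a i by rewrite /b liftK.
move=> i; rewrite -bE; apply: ind.
rewrite big_ord_recl {1}/b unlift_none scale0r add0r -[RHS]sa.
by apply: eq_bigr => j _; rewrite bE.
Qed.

(** * Equidistant simplices *)

(** A d-simplex that fails to resolve s1 and s2 extends to a (d + 1)-simplex
    with the same defect. Any y outside its affine span can be moved in the
    direction x of s2 - s1, which lies in the span, onto the bisector of s1
    and s2; the moved point P is still outside the span. *)
Lemma SRS_pred d : SRS d.+1 X -> dim_ge X d.+1 -> SRS d X.
Proof.
move=> srs dimX p pind s1 s2 h1 h2 eqd.
have [l1 l1s s1E] := convex_hull_affine h1.
have [l2 l2s s2E] := convex_hull_affine h2.
have [y yspan] :=
  dim_ge_not_span (fun i : 'I_d => p (lift ord0 i) - p ord0) dimX.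
pose x := 2^-1 *: (s2 - s1); pose c := 2^-1 *: (s1 + s2).
have [a ga] := birkhoff_foot (p ord0 + y - c) x.
have [t _ bt] := bisector_near ga.
pose P := p ord0 + y + (a + t) *: x.
pose p' (i : 'I_d.+2) := if unlift ord0 i is Some j then p j else P.
have p'0 : p' ord0 = P by rewrite /p' unlift_none.
have p'S j : p' (lift ord0 j) = p j by rewrite /p' liftK.
have hull_incl : convex_hull (range p) `<=` convex_hull (range p').
  apply: convex_hull_sub; first exact: convex_hull_convex.
  move=> _ [j _ <-]; apply: sub_convex_hull.
  by exists (lift ord0 j) => //; rewrite p'S.
apply: (srs p' _ s1 s2 (hull_incl _ h1) (hull_incl _ h2)).
  move=> k ks; rewrite big_ord_recl p'0.
  under eq_bigr do rewrite p'S.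
  move: ks; rewrite big_ord_recl => ks k0.
  pose v i := - k ord0 * ((a + t) * 2^-1 * (l2 i - l1 i)) - k (lift ord0 i).
  have vs : \sum_(i < d.+1) v i = k ord0.
    rewrite big_split/= -mulr_sumr -mulr_sumr !big_split/= !sumrN l1s l2s subrr.
    rewrite !mulr0 add0r; apply/esym/eqP; rewrite -subr_eq0 opprK; exact/eqP.
  (* Solving the affine relation k for the new direction y: since the weights
     v sum to k ord0, the multiples of p ord0 cancel. *)
  have vp : k ord0 *: y = \sum_(i < d.+1) v i *: (p i - p ord0).
    under eq_bigr do rewrite scalerBr.
    rewrite big_split/= sumrN -scaler_suml vs.
    have -> : \sum_(i < d.+1) v i *: p i =
        - k ord0 *: ((a + t) *: x) - \sum_(i < d.+1) k (lift ord0 i) *: p i.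
      rewrite /x s1E s2E -sumrN -big_split/= !scaler_sumr -sumrN -big_split/=.
      apply: eq_bigr => i _; rewrite /v; vec.
    move/eqP: k0; rewrite addr_eq0 => /eqP.
    by rewrite -[X in _ - X]opprK => <-; rewrite /P; vec.
  have k00 : k ord0 = 0.
    apply/eqP/negPn/negP => k0n.
    apply: (yspan (fun i => (k ord0)^-1 * v (lift ord0 i))).
    apply: (scalerI k0n); rewrite vp big_ord_recl subrr scaler0 add0r.
    rewrite scaler_sumr; apply: eq_bigr => i _.
    by rewrite !scalerA mulrA divff// mul1r.
  have kS : forall i, k (lift ord0 i) = 0.
    apply: pind; first by move: ks; rewrite k00 add0r.
    by move: k0; rewrite k00 scale0r add0r.
  by move=> i; case: (unliftP ord0 i) => [j ->|->].
move=> _ [i _ <-]; case: (unliftP ord0 i) => [j ->|->].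
  by rewrite p'S; apply: eqd; exists j.
rewrite p'0.
have -> : P - s1 = p ord0 + y - c + a *: x + t *: x + x.
  by rewrite /P /c /x; module_eq R X; field.
rewrite -bt; congr Num.norm.
by rewrite /P /c /x; module_eq R X; field.
Qed.

(** Let the simplex g be centred at the origin, with vertices orthogonal to x.
    Blow it up by a large factor T and move each vertex by at most |x| along x
    so as to be equidistant from - x and x. The new vertices p i are still
    affinely independent, and their hull still contains - x and x, since T is
    large compared with the coordinates xi of x. So x = - x. *)
Lemma SRS_centered_simplex d (g : 'I_d.+1 -> X) (xi : 'I_d.+1 -> R) x :
  SRS d X -> affinely_independent g -> \sum_(i < d.+1) g i = 0 ->
  \sum_(i < d.+1) xi i = 0 -> \sum_(i < d.+1) xi i *: g i = x ->
  (forall i, g i _|_ x) -> x = 0.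
Proof.
move=> srs gind gs xis xig gx.
pose K := \sum_(i < d.+1) `|xi i|; pose N : R := d.+1%:R.
pose T := (2 * N + 1) * K + 1.
have N0 : 0 < N by rewrite ltr0n.
have K0 : 0 <= K by rewrite sumr_ge0.
have xiK i : `|xi i| <= K by rewrite /K (bigD1 i)//= lerDl sumr_ge0.
have NK0 : 0 <= N * K by rewrite mulr_ge0// ltW.
have T0 : 0 < T by rewrite /T; lra.
have /choice[t tP] : forall i, exists t : R, `|t| <= 1 /\
    `|T *: g i + t *: x - x| = `|T *: g i + t *: x + x|.
  by move=> i; have /bisector_near[t] := birkhoffZl T (gx i); exists t.
pose p i := T *: g i + t i *: x.
pose tau := \sum_(i < d.+1) xi i * t i.
have tauK : `|tau| <= K.
  apply: le_trans (ler_norm_sum _ _ _) _; apply: ler_sum => i _.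
  by rewrite normrM ler_piMr// (tP i).1.
(* T is chosen to make this hold: weights N^-1 + sg * xi i with
   |sg| <= 2 / (T + tau) are then nonnegative. *)
have Ttau : 2 * N * K < T + tau by move: tauK; rewrite ler_norml /T; lra.
have Ttau0 : 0 < T + tau by lra.
have pind : affinely_independent p.
  move=> a as0 ap; pose s := \sum_(i < d.+1) a i * t i.
  have c0 i : T * a i + s * xi i = 0.
    move: i; apply: gind.
      by rewrite big_split/= -!mulr_sumr as0 xis !mulr0 addr0.
    under eq_bigr do rewrite scalerDl -!scalerA.
    rewrite big_split/= -!scaler_sumr xig -[RHS]ap.
    rewrite scaler_suml scaler_sumr -big_split/=.
    by apply: eq_bigr => i _; rewrite /p; vec.
  have : s * (T + tau) = 0.
    rewrite mulrDr /tau {1}/s mulr_suml mulr_sumr -big_split big1//= => i _.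
    by rewrite -[RHS](mulr0 (t i)) -(c0 i); ring.
  move=> /eqP; rewrite mulf_eq0 (gt_eqF Ttau0) orbF => /eqP s0 i.
  have := c0 i; rewrite s0 mul0r addr0 => /eqP.
  by rewrite mulf_eq0 (gt_eqF T0) => /eqP.
pose m := (\sum_(i < d.+1) t i) / N.
have m1 : `|m| <= 1.
  rewrite normrM normfV (gtr0_norm N0) ler_pdivrMr// mul1r.
  apply: le_trans (ler_norm_sum _ _ _) _.
  apply: (@le_trans _ _ (\sum_(i < d.+1) (1 : R))).
    by apply: ler_sum => i _; exact: (tP i).1.
  by rewrite sumr_const card_ord.
have hull (e : R) : `|e| = 1 -> convex_hull (range p) (e *: x).
  move=> e1; pose sg := (e - m) / (T + tau).
  (* Barycentric coordinates of e x: perturb the centroid in the direction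
     xi of x; sg corrects for the displacements t i. *)
  pose l i := N^-1 + sg * xi i.
  have -> : e *: x = \sum_(i < d.+1) l i *: p i.
    have -> : \sum_(i < d.+1) l i *: p i =
       (N^-1 * T) *: (\sum_(i < d.+1) g i) +
       (sg * T) *: (\sum_(i < d.+1) xi i *: g i) +
       (N^-1 * (\sum_(i < d.+1) t i)) *: x + (sg * tau) *: x.
      rewrite /tau !mulr_sumr !scaler_suml !scaler_sumr -!big_split/=.
      by apply: eq_bigr => i _; rewrite /l /p; vec.
    rewrite gs xig scaler0 add0r -!scalerDl; congr (_ *: _).
    rewrite /sg /m; field; rewrite /= !gt_eqF//.
  apply: convex_hull_sum.
    move=> i; suff : `|sg * xi i| <= N^-1.
      by rewrite ler_norml => /andP[h _]; rewrite /l addrC -lerBlDr sub0r.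
    rewrite -[leRHS]mul1r ler_pdivlMr// normrM.
    rewrite /sg normrM normfV (gtr0_norm Ttau0) !(mulrAC _ _^-1).
    rewrite ler_pdivrMr// mul1r.
    apply: le_trans (ltW Ttau).
    have em : `|e - m| <= 2.
      by have := ler_normB e m; rewrite e1; move: m1; lra.
    have : `|e - m| * `|xi i| <= 2 * K by apply: ler_pM.
    move=> /(ler_wpM2r (ltW N0)) /le_trans; apply; lra.
  rewrite big_split/= -mulr_sumr xis mulr0 addr0 sumr_const card_ord -mulr_natr.
  by rewrite mulVf// gt_eqF.
have : 1 *: x = -1 *: x.
  apply: (srs p pind); [by apply: hull; rewrite normr1|
    by apply: hull; rewrite normrN1 |].
  by move=> _ [i _ <-]; rewrite scale1r scaleN1r opprK; exact: (tP i).2.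
rewrite scale1r scaleN1r => /eqP; rewrite -addr_eq0 -mulr2n -scaler_nat.
by rewrite scaler_eq0 pnatr_eq0 => /eqP.
Qed.

(** * Left additivity from resolving tetrahedra *)

Definition independent3 u v w :=
  forall a b c, a *: u + b *: v + c *: w = 0 -> [/\ a = 0, b = 0 & c = 0].

(** Scaling and changing signs turns four vectors of the cone orthogonal to x,
    no three of them dependent, into the vertices of a tetrahedron centred at
    the origin. *)
Lemma SRS3_general_position g1 g2 g3 c1 c2 c3 xi1 xi2 xi3 x :
  SRS 3 X -> independent3 g1 g2 g3 -> c1 != 0 -> c2 != 0 -> c3 != 0 ->
  x = xi1 *: g1 + xi2 *: g2 + xi3 *: g3 ->
  g1 _|_ x -> g2 _|_ x -> g3 _|_ x -> c1 *: g1 + c2 *: g2 + c3 *: g3 _|_ x ->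
  x = 0.
Proof.
move=> srs ind c10 c20 c30 xE o1 o2 o3 o4.
pose g (i : 'I_4) := nth 0 [:: c1 *: g1; c2 *: g2; c3 *: g3;
   - (c1 *: g1 + c2 *: g2 + c3 *: g3)] i.
(* Subtracting the mean makes the coordinates of x sum to zero; this does
   not change the vector because the vertices sum to zero. *)
pose mu := (xi1 / c1 + xi2 / c2 + xi3 / c3) / 4.
pose xi (i : 'I_4) :=
  nth 0 [:: xi1 / c1 - mu; xi2 / c2 - mu; xi3 / c3 - mu; - mu] i.
have sumX (F : 'I_4 -> X) : \sum_(i < 4) F i =
    F ord0 + F (lift ord0 ord0) + F (lift ord0 (lift ord0 ord0)) +
    F (lift ord0 (lift ord0 (lift ord0 ord0))).
  by rewrite !big_ord_recl big_ord0 !addrA addr0.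
have sumR (F : 'I_4 -> R) : \sum_(i < 4) F i =
    F ord0 + F (lift ord0 ord0) + F (lift ord0 (lift ord0 ord0)) +
    F (lift ord0 (lift ord0 (lift ord0 ord0))).
  by rewrite !big_ord_recl big_ord0 !addrA addr0.
apply: (@SRS_centered_simplex 3 g xi) => //.
- move=> a; rewrite sumX sumR /g /=.
  set a1 := a ord0; set a2 := a (lift ord0 ord0).
  set a3 := a (lift ord0 (lift ord0 ord0)).
  set a4 := a (lift ord0 (lift ord0 (lift ord0 ord0))) => as0 ag.
  have [] := ind ((a1 - a4) * c1) ((a2 - a4) * c2) ((a3 - a4) * c3).
    by rewrite -[RHS]ag; vec.
  move=> /eqP; rewrite mulf_eq0 (negbTE c10) orbF subr_eq0 => /eqP a14.
  move=> /eqP; rewrite mulf_eq0 (negbTE c20) orbF subr_eq0 => /eqP a24.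
  move=> /eqP; rewrite mulf_eq0 (negbTE c30) orbF subr_eq0 => /eqP a34.
  have a40 : a4 = 0 by move: as0; rewrite a14 a24 a34; lra.
  move=> i; case: (unliftP ord0 i) => [{}i ->|->]; last by rewrite -/a1 a14.
  case: (unliftP ord0 i) => [{}i ->|->]; last by rewrite -/a2 a24.
  case: (unliftP ord0 i) => [{}i ->|->]; last by rewrite -/a3 a34.
  by rewrite (ord1 i).
- by rewrite sumX /g /=; vec.
- by rewrite sumR /xi /= /mu; field; rewrite c10 c20 c30.
- rewrite sumX /g /xi /= xE.
  by module_eq R X; field; rewrite ?c10 ?c20 ?c30.
- move=> i; rewrite -[x]scale1r; case: (unliftP ord0 i) => [{}i ->|->].
    case: (unliftP ord0 i) => [{}i ->|->].
      case: (unliftP ord0 i) => [{}i ->|->].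
        by rewrite (ord1 i) /g /= -scaleN1r; exact: birkhoffZ.
      exact: birkhoffZ.
    exact: birkhoffZ.
  exact: birkhoffZ.
Qed.

Lemma dim3_not_span u v : dim_ge X 3 ->
  exists y, forall a b, y <> a *: u + b *: v.
Proof.
move=> /(@dim_ge_not_span 2 (fun i => nth 0 [:: u; v] i))[y yP].
exists y => a b ye; apply: (yP (fun i => nth 0 [:: a; b] i)).
by rewrite !big_ord_recl big_ord0 /= addr0.
Qed.

(** If z and z + c x were both orthogonal to x, so would be all points between
    them. Two of these, together with the feet y1 and y2 of the lines through
    some y outside the plane of z and x and through y1 + z, are in general
    position as soon as they avoid the point z + d x = y2 - y1. *)
Lemma birkhoff_foot_unique z x c : SRS 3 X -> dim_ge X 3 -> x != 0 ->
  z _|_ x -> z + c *: x _|_ x -> c = 0.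
Proof.
move=> srs dimX x0 zx zcx; apply/eqP/negPn/negP => c0.
have [y yP] := dim3_not_span z x dimX.
have ind : independent3 z x y.
  move=> a b e ab0; have [e0|e0] := eqVneq e 0; last first.
    exfalso; apply: (yP (- a / e) (- b / e)).
    have -> : y = (- a / e) *: z + (- b / e) *: x +
        e^-1 *: (a *: z + b *: x + e *: y).
      by module_eq R X; field.
    by rewrite ab0 scaler0 addr0.
  move: ab0; rewrite e0 scale0r addr0 => ab0.
  have [a0|a0] := eqVneq a 0.
    move/eqP: ab0; rewrite a0 scale0r add0r scaler_eq0 (negbTE x0) orbF.
    by move=> /eqP.
  have zE : z = (- b / a) *: x.
    have -> : z = (- b / a) *: x + a^-1 *: (a *: z + b *: x).
      by module_eq R X; field.
    by rewrite ab0 scaler0 addr0.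
  have b0 : - b / a = 0 by apply: (birkhoff_self x0); rewrite -zE.
  move: zcx; rewrite zE b0 scale0r add0r => /(birkhoff_self x0) cz.
  by rewrite cz eqxx in c0.
have [g y1x] := birkhoff_foot y x; set y1 := y + g *: x in y1x.
have [d y2x] := birkhoff_foot (y1 + z) x.
have absurd s s' : z + s *: x _|_ x -> z + s' *: x _|_ x -> s != s' ->
    d != s -> d != s' -> False.
  move=> sx s'x; rewrite -subr_eq0 => ss' ds ds'.
  move/eqP: x0; apply.
  apply: (@SRS3_general_position (z + s *: x) (z + s' *: x) y1
    ((d - s') / (s - s')) ((s - d) / (s - s')) 1
    (s - s')^-1 (- (s - s')^-1) 0) => //.
  - move=> a b e; rewrite /y1 => abe.
    have [] := ind (a + b) (a * s + b * s' + e * g) e.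
      by rewrite -[RHS]abe; vec.
    move=> ab0 h e0; move: h; rewrite e0 mul0r addr0 => h.
    have : a * (s - s') = 0.
      by rewrite -[RHS]h; (have -> : b = - a by lra); ring.
    move=> /eqP; rewrite mulf_eq0 (negbTE ss') orbF => /eqP a0; split => //.
    by move: ab0; rewrite a0 add0r.
  - by apply: mulf_neq0; rewrite ?invr_neq0// subr_eq0.
  - by apply: mulf_neq0; rewrite ?invr_neq0// subr_eq0 eq_sym.
  - by module_eq R X; field.
  - suff <- : y1 + z + d *: x = ((d - s') / (s - s')) *: (z + s *: x) +
      ((s - d) / (s - s')) *: (z + s' *: x) + 1 *: y1 by [].
    by module_eq R X; field.
have zc : `|z + c *: x| = `|z|.
  apply/eqP; rewrite eq_le zx andbT.
  by have := zcx (- c); have -> : z + c *: x + - c *: x = z by vec.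
have mid : z + (c / 2) *: x _|_ x.
  move=> t; apply: le_trans (_ : `|z| <= _); last first.
    by have := zx (c / 2 + t); rewrite scalerDl addrA.
  have -> : z + (c / 2) *: x = 2^-1 *: z + 2^-1 *: (z + c *: x).
    by module_eq R X; field.
  apply: le_trans (ler_normD _ _) _; rewrite !normrZ zc normfV normr_nat; lra.
have z0 : z + 0 *: x _|_ x by rewrite scale0r addr0.
have h2 : c / 2 != 0 by apply: mulf_neq0 => //; rewrite invr_neq0// pnatr_eq0.
have hc : c / 2 != c by apply: contra c0 => /eqP h; apply/eqP; lra.
(* Among z, z + (c / 2) x and z + c x, at most one is excluded by d. *)
have [d0|d0] := eqVneq d 0.
  by apply: (absurd (c / 2) c); rewrite // d0 eq_sym.
have [dc|dc] := eqVneq d c.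
  by apply: (absurd 0 (c / 2)); rewrite // eq_sym// dc.
by apply: (absurd 0 c); rewrite // eq_sym.
Qed.

(** Along a line the norm is nondecreasing away from its minimum. *)
Lemma birkhoff_monotone y x t k : y _|_ x -> 0 <= k -> k <= 1 ->
  `|y + (k * t) *: x| <= `|y + t *: x|.
Proof.
move=> yx k0 k1.
have -> : y + (k * t) *: x = (1 - k) *: y + k *: (y + t *: x) by vec.
apply: le_trans (ler_normD _ _) _; rewrite !normrZ !ger0_norm ?subr_ge0//.
have := yx t; nra.
Qed.

(** For e <> 0 the norm at phi b0 + e strictly exceeds its minimum at phi b0,
    and a gap persists for b near b0. By [birkhoff_monotone], phi b0 + e then
    does not lie between phi b0 and phi b; taking e of both signs bounds the
    distance from phi b to phi b0. *)
Lemma foot_continuous p q x (phi : R -> R) :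
  (forall b, p + b *: q + phi b *: x _|_ x) ->
  (forall b s, p + b *: q + s *: x _|_ x -> s = phi b) ->
  continuous phi.
Proof.
move=> phiP phiU b0.
have side (e : R) : e != 0 -> exists2 eta, 0 < eta &
    forall b, `|b0 - b| < eta -> forall k : R, 0 <= k -> k <= 1 ->
    phi b0 + e != phi b + k * (phi b0 - phi b).
  move=> e0.
  pose gap := `|p + b0 *: q + (phi b0 + e) *: x| - `|p + b0 *: q + phi b0 *: x|.
  have gap0 : 0 < gap.
    rewrite subr_gt0 lt_neqAle; apply/andP; split.
      apply/eqP => eqn; move/eqP: e0; apply.
      suff : phi b0 + e = phi b0 by lra.
      apply: phiU => t; rewrite -eqn.
      have := phiP b0 (e + t).
      by congr (_ <= Num.norm _); vec.
    have := phiP b0 e.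
    by congr (_ <= Num.norm _); vec.
  exists (gap / 2 / (`|q| + 1)).
    by rewrite !divr_gt0// ltr_wpDl.
  move=> b bb0 k k0 k1; apply/eqP => eqk.
  have lip s : `|(`|p + b0 *: q + s *: x| - `|p + b *: q + s *: x|)| < gap / 2.
    apply: le_lt_trans (ler_dist_dist _ _) _.
    have -> : p + b0 *: q + s *: x - (p + b *: q + s *: x) = (b0 - b) *: q.
      by vec.
    rewrite normrZ.
    apply: le_lt_trans (_ : `|b0 - b| * (`|q| + 1) < _).
      by rewrite ler_wpM2l// lerDl.
    by rewrite -ltr_pdivlMr// ltr_wpDl.
  have := birkhoff_monotone (phi b0 - phi b) (phiP b) k0 k1.
  have -> : p + b *: q + phi b *: x + (k * (phi b0 - phi b)) *: x =
      p + b *: q + (phi b0 + e) *: x by rewrite eqk; vec.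
  have -> : p + b *: q + phi b *: x + (phi b0 - phi b) *: x =
      p + b *: q + phi b0 *: x by vec.
  have := lip (phi b0); have := lip (phi b0 + e).
  by rewrite !ltr_norml /gap; lra.
apply/cvgrPdist_le => /= eps eps0.
have [|eta1 eta10 h1] := side eps; first by rewrite gt_eqF.
have [|eta2 eta20 h2] := side (- eps); first by rewrite oppr_eq0 gt_eqF.
near=> b.
have b1 : `|b0 - b| < eta1.
  by near: b; apply: (@cvgr_dist_lt _ _ _ (nbhs b0) _ id b0) => //;
    exact: cvg_id.
have b2 : `|b0 - b| < eta2.
  by near: b; apply: (@cvgr_dist_lt _ _ _ (nbhs b0) _ id b0) => //;
    exact: cvg_id.
rewrite ler_norml; apply/andP; split; rewrite leNgt; apply/negP => lt.
  have d0 : phi b0 - phi b < 0 by lra.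
  pose k := (phi b0 + eps - phi b) / (phi b0 - phi b).
  have kE : k * (phi b0 - phi b) = phi b0 + eps - phi b.
    by rewrite /k divfK ?lt_eqF.
  have k0 : 0 <= k by nra.
  have k1 : k <= 1 by nra.
  by have /eqP := h1 _ b1 k k0 k1; apply; rewrite kE; ring.
have d0 : 0 < phi b0 - phi b by lra.
pose k := (phi b0 - eps - phi b) / (phi b0 - phi b).
have kE : k * (phi b0 - phi b) = phi b0 - eps - phi b.
  by rewrite /k divfK ?gt_eqF.
have k0 : 0 <= k by nra.
have k1 : k <= 1 by nra.
by have /eqP := h2 _ b2 k k0 k1; apply; rewrite kE; ring.
Unshelve. all: by end_near. Qed.

(** Let p and q be orthogonal to x and p + b q + phi(b) x be the foot of
    p + b q, so that phi 0 = 0 and a := phi 1 must vanish. The feet at b1, b2,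
    b3 and q are in general position unless two values of phi agree or the
    three points of the graph are aligned. If a <> 0, then phi takes the values
    a / 3 and 2 a / 3, and this alignment forces phi b = a b for all b.
    Dividing p + b q + a b x by b and letting b tend to infinity makes
    q + a x orthogonal to x, which contradicts the uniqueness of the foot
    q. *)
Lemma SRS3_birkhoff_left_additive :
  SRS 3 X -> dim_ge X 3 -> birkhoff_left_additive X.
Proof.
move=> srs dimX p q x px qx; have [->|x0] := eqVneq x 0.
  by move=> t; rewrite scaler0 addr0.
have uniq := birkhoff_foot_unique srs dimX x0.
have uniq2 z s t : z + s *: x _|_ x -> z + t *: x _|_ x -> s = t.
  move=> zs zt; have := uniq (z + s *: x) (t - s) zs.
  have -> : z + s *: x + (t - s) *: x = z + t *: x by vec.
  by move=> /(_ zt); lra.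
apply: contrapT => npq.
have ind : independent3 p q x.
  move=> a b c abc0; have [b0|b0] := eqVneq b 0; last first.
    exfalso; apply: npq.
    have qE : q = (- a / b) *: p + (- c / b) *: x.
      have -> : q = (- a / b) *: p + (- c / b) *: x +
          b^-1 *: (a *: p + b *: q + c *: x) by module_eq R X; field.
      by rewrite abc0 scaler0 addr0.
    have c0 : - c / b = 0.
      apply: (uniq ((- a / b) *: p)); last by rewrite -qE.
      exact: birkhoffZl.
    rewrite qE c0 scale0r addr0.
    have -> : p + (- a / b) *: p = (1 - a / b) *: p by vec.
    exact: birkhoffZl.
  move: abc0; rewrite b0 scale0r addr0 => ac0.
  have [a0|a0] := eqVneq a 0.
    move/eqP: ac0; rewrite a0 scale0r add0r scaler_eq0 (negbTE x0) orbF.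
    by move=> /eqP.
  exfalso; apply: npq.
  have pE : p = (- c / a) *: x.
    have -> : p = (- c / a) *: x + a^-1 *: (a *: p + c *: x).
      by module_eq R X; field.
    by rewrite ac0 scaler0 addr0.
  have c0 : - c / a = 0 by apply: (birkhoff_self x0); rewrite -pE.
  by rewrite pE c0 scale0r add0r.
have /choice[phi phiP] : forall b, exists s : R, p + b *: q + s *: x _|_ x.
  by move=> b; exact: birkhoff_foot.
have phiU b s : p + b *: q + s *: x _|_ x -> s = phi b.
  by move=> /uniq2; apply; exact: phiP.
have cphi : continuous phi := foot_continuous phiP phiU.
have phi0 : phi 0 = 0.
  by apply/esym/phiU; rewrite !scale0r !addr0.
have collinear b1 b2 b3 :
    phi b1 != phi b2 -> phi b3 != phi b1 -> phi b3 != phi b2 ->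
    (phi b1 - phi b2) * b3 = (phi b3 - phi b2) * b1 + (phi b1 - phi b3) * b2.
  move=> n12 n31 n32.
  have d12 : phi b1 - phi b2 != 0 by rewrite subr_eq0.
  apply: contrapT => ncol; move/eqP: x0; apply.
  pose c1 := (phi b3 - phi b2) / (phi b1 - phi b2).
  pose c2 := (phi b1 - phi b3) / (phi b1 - phi b2).
  apply: (@SRS3_general_position (p + b1 *: q + phi b1 *: x)
    (p + b2 *: q + phi b2 *: x) q c1 c2 (b3 - c1 * b1 - c2 * b2)
    (phi b1 - phi b2)^-1 (- (phi b1 - phi b2)^-1)
    (- (b1 - b2) / (phi b1 - phi b2))) => //.
  - move=> a b c abc.
    have [] := ind (a + b) (a * b1 + b * b2 + c) (a * phi b1 + b * phi b2).
      by rewrite -[RHS]abc; vec.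
    move=> ab0 c0 h; have bE : b = - a by lra.
    have : a * (phi b1 - phi b2) = 0 by rewrite -[RHS]h bE; ring.
    move=> /eqP; rewrite mulf_eq0 (negbTE d12) orbF => /eqP a0.
    by split=> //; [rewrite bE a0 oppr0 | rewrite -[RHS]c0 bE a0; ring].
  - by apply: mulf_neq0; rewrite ?invr_neq0// subr_eq0.
  - by apply: mulf_neq0; rewrite ?invr_neq0// subr_eq0 eq_sym.
  - apply/eqP => h; apply: ncol.
    have b3E : b3 = c1 * b1 + c2 * b2 by lra.
    by rewrite {1}b3E /c1 /c2; field.
  - by module_eq R X; field.
  - suff <- : p + b3 *: q + phi b3 *: x = c1 *: (p + b1 *: q + phi b1 *: x) +
      c2 *: (p + b2 *: q + phi b2 *: x) + (b3 - c1 * b1 - c2 * b2) *: q by [].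
    by rewrite /c1 /c2; module_eq R X; field.
pose a := phi 1.
have a0 : a != 0.
  apply/eqP => a0; apply: npq; have := phiP 1.
  by rewrite -/a a0 scale0r addr0 scale1r.
have ivt k : 0 <= k -> k <= 1 -> exists2 b, 0 <= b & phi b = k * a.
  move=> k0 k1; have [|||b] := @IVT R phi 0 1 (k * a); first exact: ler01.
  - exact: continuous_subspaceT.
  - rewrite phi0 -/a ge_min le_max.
    by have [a1|a1] := leP 0 a; apply/andP; split; apply/orP; nra.
  by rewrite in_itv/= => /andP[b0 _] bE; exists b.
(* Alignment with the points of parameters 0 and 1. *)
have off b : phi b != 0 -> phi b != a -> phi b = a * b.
  move=> n0 na; have := collinear 0 1 b; rewrite phi0 -/a eq_sym.
  move=> /(_ a0 n0 na).
  by rewrite mulr0 mulr1 !add0r; lra.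
have third k : 0 <= k -> k <= 1 -> k != 0 -> k != 1 -> phi k = k * a.
  move=> k0 k1 kn0 kn1; have [b _ bE] := ivt k k0 k1.
  have n0 : phi b != 0 by rewrite bE mulf_neq0.
  have na : phi b != a.
    by rewrite bE -subr_eq0 -[X in _ - X]mul1r -mulrBl mulf_neq0// subr_eq0.
  have := off b n0 na; rewrite bE mulrC => /(mulfI a0) kb.
  by rewrite [in LHS]kb bE mulrC.
have phi1 : phi (1 / 3) = a / 3.
  by rewrite third; [field|lra|lra|apply/eqP; lra|apply/eqP; lra].
have phi2 : phi (2 / 3) = 2 * a / 3.
  by rewrite third; [field|lra|lra|apply/eqP; lra|apply/eqP; lra].
(* If phi b is 0 or a, the points of parameters 1/3 and 2/3 serve
   instead. *)
have lin b : phi b = a * b.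
  have [pb0|n0] := eqVneq (phi b) 0; last first.
    have [pba|na] := eqVneq (phi b) a; last exact: off.
    have := collinear (1 / 3) (2 / 3) b; rewrite phi1 phi2 pba.
    suff [-> -> ->] : [/\ a / 3 != 2 * a / 3, a != a / 3 & a != 2 * a / 3].
      by move=> /(_ isT isT isT); lra.
    by split; apply: contra a0 => /eqP h; apply/eqP; lra.
  have := collinear (1 / 3) (2 / 3) b; rewrite phi1 phi2 pb0.
  suff [-> -> ->] : [/\ a / 3 != 2 * a / 3, 0 != a / 3 & 0 != 2 * a / 3].
    by move=> /(_ isT isT isT); lra.
  by split; apply: contra a0 => /eqP h; apply/eqP; lra.
(* Rescaled by s = 1 / b, the foot at b is within s |p| of q + a x. *)
suff : q + a *: x _|_ x by move=> /(uniq _ _ qx) /eqP; rewrite (negbTE a0).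
move=> t; apply/ler_addgt0Pr => e e0.
pose s := e / (2 * `|p| + 1).
have d0 : 0 < 2 * `|p| + 1 by rewrite ltr_wpDl// mulr_ge0.
have s0 : 0 < s by rewrite divr_gt0.
have se : 2 * (s * `|p|) <= e.
  have -> : 2 * (s * `|p|) = e * (2 * `|p|) / (2 * `|p| + 1).
    by rewrite /s; ring.
  by rewrite ler_pdivrMr// ler_pM2l// lerDl.
have := birkhoffZ s 1 (phiP s^-1); rewrite scale1r lin => /(_ t).
have -> : s *: (p + s^-1 *: q + (a * s^-1) *: x) = (q + a *: x) + s *: p.
  by module_eq R X; field; rewrite gt_eqF.
have := ler_normB (q + a *: x + s *: p) (s *: p); rewrite addrK.
have := ler_normD (q + a *: x + t *: x) (s *: p).
have -> : q + a *: x + t *: x + s *: p = q + a *: x + s *: p + t *: x by vec.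
rewrite normrZ (gtr0_norm s0); lra.
Qed.

(** * From Birkhoff to isosceles orthogonality *)

(** The component along x is removed before the component along w. *)
Lemma birkhoff_plane p w x a b :
  p _|_ w -> (forall t, p + t *: w _|_ x) -> p _|_ a *: x + b *: w.
Proof.
move=> pw pwx t.
have -> : p + t *: (a *: x + b *: w) = p + (t * b) *: w + (t * a) *: x by vec.
exact: le_trans (pw _) (pwx _ _).
Qed.

(** Write x s for the point u + s (v - u) of the segment from u to v, N s for
    its norm, and psi s for the distance from - e to its radial projection on
    the unit circle. Let m s be a subgradient of N at s and y the direction of
    the corresponding supporting line at x s. Left additivity keeps all of
    e + lam (x s) orthogonal to y, so moving along y increases the distance to
    - e; hence psi drops from s to t by at most a multiple of the error
    N t - N s - (t - s) m s of the linear approximation. Exchanging s and t,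
    the variation of psi is bounded by (t - s) (m t - m s), and psi is
    constant. *)
Lemma unit_circle_equidistant u v e :
  birkhoff_left_additive X ->
  `|u| = 1 -> `|v| = 1 -> v _|_ u ->
  (forall a b, e _|_ a *: u + b *: v) -> `|u + e| = `|v + e|.
Proof.
move=> hD u1 v1 vu eE; pose d := v - u; pose x s := u + s *: d.
pose N s := `|x s|; pose psi s := `|(N s)^-1 *: x s + e|.
(* As v is orthogonal to u, N s is at least |s|, and it is at least
   |1 - s| - |s| by the triangle inequality. *)
have N3 s : 3^-1 <= N s.
  have xE : x s = (1 - s) *: u + s *: v by rewrite /x /d; vec.
  have h1 : `|s| <= N s.
    have <- : `|s *: v| = `|s| by rewrite normrZ v1 mulr1.
    have := birkhoffZ s 1 vu (1 - s); rewrite scale1r => /le_trans; apply.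
    by rewrite /N xE addrC.
  have h2 : `|1 - s| <= N s + `|s|.
    have <- : `|(1 - s) *: u| = `|1 - s| by rewrite normrZ u1 mulr1.
    have -> : (1 - s) *: u = x s - s *: v by rewrite xE; vec.
    by apply: le_trans (ler_normB _ _) _; rewrite normrZ v1 mulr1.
  have := ler_normD (1 - s) s; rewrite subrK normr1; lra.
have N0 s : 0 < N s by apply: lt_le_trans (N3 s); rewrite invr_gt0.
have /choice[m mP] : forall s, exists k : R,
    forall a b, a * N s + b * k <= `|a *: x s + b *: d|.
  by move=> s; exact: norm_subgradient.
have xD s t : x t = x s + (t - s) *: d by rewrite /x; vec.
have Nsub s t : N s + (t - s) * m s <= N t.
  by have := mP s 1 (t - s); rewrite mul1r scale1r -xD.
have low s t : psi s - 3 * (N t - N s - (t - s) * m s) <= psi t.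
  (* The supporting functional at x s takes the value lam on the unit vector
     of direction x t. *)
  pose lam := (N s + (t - s) * m s) / N t.
  pose y := d - (m s / N s) *: x s.
  have xy : x s _|_ y.
    move=> k; have := mP s (1 - k * (m s / N s)) k.
    have -> : (1 - k * (m s / N s)) * N s + k * m s = N s.
      by field; rewrite gt_eqF.
    by congr (_ <= Num.norm _); rewrite /y; vec.
  have ey : e _|_ y.
    have -> : y = (- 1 - (m s / N s) * (1 - s)) *: u + (1 - m s / N s * s) *: v.
      by rewrite /y /x /d; vec.
    exact: eE.
  have zy : (lam / N s) *: x s + e _|_ y.
    by apply: hD => //; exact: birkhoffZl.
  have h1 : `|(lam / N s) *: x s + e| <= psi t.
    have := zy ((t - s) / N t); rewrite /psi; congr (_ <= Num.norm _).
    rewrite (xD s t) /y /lam; module_eq R X; field; rewrite ?gt_eqF//.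
  have lam1 : 1 - lam = (N t - N s - (t - s) * m s) / N t.
    by rewrite /lam; field; rewrite gt_eqF.
  have lam0 : 0 <= 1 - lam.
    by rewrite lam1; apply: divr_ge0; [have := Nsub s t; lra | exact: ltW].
  have lam3 : 1 - lam <= 3 * (N t - N s - (t - s) * m s).
    rewrite lam1 ler_pdivrMr// mulrAC ler_peMl//.
      by have := Nsub s t; lra.
    by have := N3 t; lra.
  have h2 : psi s <= `|(lam / N s) *: x s + e| + (1 - lam).
    have -> : 1 - lam = `|((1 - lam) / N s) *: x s|.
      rewrite normrZ normrM normfV (ger0_norm lam0) (gtr0_norm (N0 s)).
      by rewrite divfK// gt_eqF.
    apply: le_trans (ler_normD _ _); rewrite /psi.
    by rewrite le_eqVlt; apply/orP; left; apply/eqP; congr Num.norm; vec.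
  lra.
have := @constant_of_square_variation R psi m 3 _ 0 1.
have -> : psi 0 = `|u + e|.
  by rewrite /psi /N /x scale0r addr0 u1 invr1 scale1r.
have -> : psi 1 = `|v + e|.
  by rewrite /psi /N /x /d scale1r [u + _]addrC subrK v1 invr1 scale1r.
apply=> s t; have := low s t; have := low t s.
have := Nsub s t; have := Nsub t s.
rewrite ler_norml; lra.
Qed.

(** In dimension 3 there is a w orthogonal to x such that e is orthogonal to
    the plane of x and w. On a circle of that plane, x and - x can both be
    compared with w. *)
Lemma birkhoff_isosceles e x :
  birkhoff_left_additive X -> dim_ge X 3 ->
  e _|_ x -> `|e + x| = `|e - x|.
Proof.
move=> hD dimX ex.
have [->|e0] := eqVneq e 0; first by rewrite !add0r normrN.
have [->|x0] := eqVneq x 0; first by rewrite subr0 addr0.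
have [y yP] := dim3_not_span e x dimX.
have [g yx] := birkhoff_foot y x.
have [a ew] := birkhoff_right_exists (y + g *: x) e0.
set w := y + g *: x + a *: e in ew.
have wx : w _|_ x by apply: hD => //; exact: birkhoffZl.
have w0 : w != 0.
  apply/eqP => w0; apply: (yP (- a) (- g)).
  have -> : y = (- a) *: e + (- g) *: x + w by rewrite /w; vec.
  by rewrite w0 addr0.
have plane k l : e _|_ k *: x + l *: w.
  apply: birkhoff_plane => // t.
  by apply: hD => //; exact: birkhoffZl.
have nx : 0 < `|x| by rewrite normr_gt0.
have nw : 0 < `|w| by rewrite normr_gt0.
have main s : `|s| = 1 ->
    `|s *: x + e| = `|x| * `| (`|w|^-1) *: w + (`|x|^-1) *: e|.
  move=> s1; rewrite -(@unit_circle_equidistant ((s / `|x|) *: x)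
    ((`|w|^-1) *: w))//.
  - rewrite -[X in _ = X * _]normr_id -normrZ; congr Num.norm.
    by module_eq R X; field; rewrite gt_eqF.
  - by rewrite normrZ normrM s1 normfV normr_id mul1r mulVf ?gt_eqF.
  - by rewrite normrZ normfV normr_id mulVf ?gt_eqF.
  - exact: birkhoffZ.
  - move=> k l; rewrite !scalerA -[X in _ _|_ X]scale1r; apply: birkhoffZ.
    exact: plane.
have h1 := main 1 (normr1 _); have h2 := main (-1) (normrN1 _).
have -> : e + x = 1 *: x + e by vec.
have -> : e - x = -1 *: x + e by vec.
by rewrite h1 h2.
Qed.

(** * The inner product *)

Lemma inner_product_of_form (form : X -> X -> R) :
  (forall x k y z, form x (k *: y + z) = k * form x y + form x z) ->
  (forall x y, form x y = form y x) ->
  (forall x, form x x = `|x| ^+ 2) -> inner_product_space X.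
Proof.
move=> lin sym sq.
have linl y k x z : form (k *: x + z) y = k * form x y + form z y.
  by rewrite sym lin !(sym y).
have bil : bilinear_for (GRing.Scale.Law.clone _ _ ( *%R ) _)
    (GRing.Scale.Law.clone _ _ (idfun \; *%R ) _) form.
  by split=> [y k x z|x k y z] /=; rewrite ?linl ?lin.
pose mB := @bilinear_isBilinear.Build R X X R _ _ form bil.
have herm x y : form x y = (-1) ^+ false * idfun (form y x).
  by rewrite expr0 mul1r sym.
pose mH := @isHermitianSesquilinear.Build R X false idfun form herm.
have pos x : x != 0 -> 0 < form x x.
  by move=> x0; rewrite sq exprn_gt0// normr_gt0.
pose mD := @isDotProduct.Build R X form pos.
pose f : {dot X for idfun} := HB.pack_for {dot X for idfun} form mB mH mD.
by exists f => x; rewrite -[f x x]/(form x x) sq sqrtr_sqr normr_id.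
Qed.

Section LeftAdditive.
Context (hD : birkhoff_left_additive X) (dimX : dim_ge X 3).

(** The difference of two feet is a multiple of x orthogonal to x. *)
Lemma left_add_unique z x s t : x != 0 ->
  z + s *: x _|_ x -> z + t *: x _|_ x -> s = t.
Proof.
move=> x0 zs zt; suff : s - t = 0 by lra.
apply: (birkhoff_self x0).
have -> : (s - t) *: x = (z + s *: x) + -1 *: (z + t *: x) by vec.
by apply: hD => //; exact: birkhoffZl.
Qed.

Lemma birkhoff_reflection p x s t : p _|_ x ->
  `|s *: p + t *: x| = `|s *: p - t *: x|.
Proof. by move=> px; apply: birkhoff_isosceles => //; exact: birkhoffZ. Qed.

(** By reflection s and t may be taken nonnegative. If the norm did not
    increase strictly, convexity would make p + t x a second minimum. *)
Lemma birkhoff_strict p x s t : x != 0 -> p _|_ x -> `|s| < `|t| ->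
  `|p + s *: x| < `|p + t *: x|.
Proof.
move=> x0 px st.
have absE r : `|p + r *: x| = `|p + `|r| *: x|.
  have [r0|r0] := leP 0 r; first by rewrite ger0_norm.
  have := birkhoff_reflection 1 r px.
  by rewrite ltr0_norm// scale1r scaleNr.
rewrite absE [ltRHS]absE.
have t0 : 0 < `|t| by apply: le_lt_trans st.
rewrite ltNge; apply/negP => le_ts.
have tp : `|p + `|t| *: x| <= `|p|.
  pose k := `|s| / `|t|.
  have k1 : k < 1 by rewrite ltr_pdivrMr ?mul1r.
  have k0 : 0 <= k by rewrite divr_ge0.
  have := ler_normD ((1 - k) *: p) (k *: (p + `|t| *: x)).
  have -> : (1 - k) *: p + k *: (p + `|t| *: x) = p + `|s| *: x.
    by rewrite /k; module_eq R X; field; rewrite gt_eqF.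
  rewrite (normrZ k) (normrZ (1 - k)) (ger0_norm k0) ger0_norm; last by lra.
  move: k0 k1 le_ts; nra.
have : p + `|t| *: x _|_ x.
  move=> r; apply: le_trans tp _; have := px (`|t| + r).
  by congr (_ <= Num.norm _); vec.
move=> tx; have := @left_add_unique p x 0 `|t| x0.
rewrite scale0r addr0 => /(_ px tx); lra.
Qed.

(** The points 2 x = u + v and 2 y = u - v lie on a line of direction v. The
    norm is even and strictly monotone about its foot u + c v, and takes equal
    values at both points, so the foot is their midpoint u. Hence u is
    orthogonal to v, and the reflection fixing u and negating v exchanges x
    and y. *)
Lemma norm_swap x y a b : `|x| = `|y| ->
  `|a *: x + b *: y| = `|b *: x + a *: y|.
Proof.
move=> xy; pose u := x + y; pose v := x - y.
have [v0|v0] := eqVneq v 0.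
  by move/eqP: v0; rewrite subr_eq0 => /eqP ->; rewrite addrC.
suff uv : u _|_ v.
  have := birkhoff_reflection ((a + b) / 2) ((a - b) / 2) uv.
  have -> : ((a + b) / 2) *: u + ((a - b) / 2) *: v = a *: x + b *: y.
    by rewrite /u /v; module_eq R X; field.
  move=> ->; congr Num.norm.
  by rewrite /u /v; module_eq R X; field.
have [c uc] := birkhoff_foot u v.
have norms : `|u + c *: v + (1 - c) *: v| = `|u + c *: v + (- 1 - c) *: v|.
  have -> : u + c *: v + (1 - c) *: v = 2 *: x by rewrite /u /v; vec.
  have -> : u + c *: v + (- 1 - c) *: v = 2 *: y by rewrite /u /v; vec.
  by rewrite !normrZ xy.
suff c0 : c = 0 by move: uc; rewrite c0 scale0r addr0.
have [lt|lt|] := ltgtP (`|1 - c|) (`|-1 - c|).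
- by have := birkhoff_strict v0 uc lt; rewrite norms ltxx.
- by have := birkhoff_strict v0 uc lt; rewrite norms ltxx.
move=> /eqP; rewrite eqr_norm2 => /orP[] /eqP; lra.
Qed.

(** The form is |x|^2 (A x y), with A x y the coefficient of the projection of
    y on x. Its symmetry for vectors of equal norm is [norm_swap]; the general
    case follows since A is homogeneous of degree 1 in y and -1 in x. *)
Lemma left_add_inner_product : inner_product_space X.
Proof.
have /choice[A AP] : forall x, exists A : X -> R, forall y, y - A y *: x _|_ x.
  move=> x; have /choice[A AP] : forall y, exists a : R, y - a *: x _|_ x.
    move=> y; have [a ya] := birkhoff_foot y x.
    by exists (- a); rewrite scaleNr opprK.
  by exists A.
have AU x y a : x != 0 -> y - a *: x _|_ x -> a = A x y.
  move=> x0 ya; suff : - a = - A x y by lra.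
  by apply: (@left_add_unique y x) => //; rewrite scaleNr.
pose form x y := `|x| ^+ 2 * A x y.
apply: (@inner_product_of_form form).
- move=> x k y z; rewrite /form.
  have [->|x0] := eqVneq x 0; first by rewrite normr0 expr0n !mul0r mulr0 addr0.
  rewrite -(AU x (k *: y + z) (k * A x y + A x z)) //; first by ring.
  have -> : k *: y + z - (k * A x y + A x z) *: x =
      k *: (y - A x y *: x) + (z - A x z *: x) by vec.
  apply: hD; last exact: AP.
  exact: birkhoffZl.
- have swap x y : x != 0 -> `|x| = `|y| -> A x y = A y x.
    move=> x0 xy; have y0 : y != 0 by rewrite -normr_eq0 -xy normr_eq0.
    apply: AU => // t; have := AP x y t.
    have -> : y - A x y *: x + t *: x = (t - A x y) *: x + 1 *: y by vec.
    have -> : y - A x y *: x = (- A x y) *: x + 1 *: y by vec.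
    rewrite (norm_swap (- A x y) _ xy) (norm_swap (t - A x y) _ xy).
    by congr (_ <= _); congr Num.norm; vec.
  move=> x y; rewrite /form.
  have z0 z : `|(0 : X)| ^+ 2 * A 0 z = 0 by rewrite normr0 expr0n mul0r.
  have A0 z : z != 0 -> A z 0 = 0.
    by move=> zn; apply/esym/AU => // t; rewrite scale0r subr0 normr0.
  have [->|x0] := eqVneq x 0.
    have [->//|y0] := eqVneq y 0; by rewrite z0 A0// mulr0.
  have [->|y0] := eqVneq y 0; first by rewrite z0 A0// mulr0.
  have nx : `|x| != 0 by rewrite normr_eq0.
  have ny : `|y| != 0 by rewrite normr_eq0.
  pose k := `|x| / `|y|.
  have k0 : k != 0 by rewrite mulf_neq0// invr_neq0.
  have : A x (k *: y) = A (k *: y) x.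
    apply: swap => //; rewrite normrZ ger0_norm ?divr_ge0//.
    by rewrite /k divfK.
  rewrite -(AU x (k *: y) (k * A x y))//; last first.
    have -> : k *: y - (k * A x y) *: x = k *: (y - A x y *: x) by vec.
    exact: birkhoffZl.
  rewrite -(AU (k *: y) x (A y x / k)); first last.
  + have -> : x - (A y x / k) *: (k *: y) = 1 *: (x - A y x *: y).
      by module_eq R X; field.
    exact: birkhoffZ.
  + by rewrite scaler_eq0 negb_or k0.
  move=> h.
  have -> : A x y = A y x / k / k by rewrite -h; field.
  by rewrite /k; field; rewrite nx ny.
- move=> x; rewrite /form; have [->|x0] := eqVneq x 0.
    by rewrite normr0 expr0n mul0r.
  rewrite -(AU x x 1) ?mulr1// => t.
  by rewrite scale1r subrr normr0.
Qed.

End LeftAdditive.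

(** * Resolving simplices in inner product spaces *)

Lemma inner_product_SRS d : inner_product_space X -> SRS d X.
Proof.
move=> [f fP] p _ s1 s2 h1 h2 eqd.
have sq x : f x x = `|x| ^+ 2.
  have f0 : 0 <= f x x.
    have [->|x0] := eqVneq x 0; first by rewrite linear0r.
    exact/ltW/neq0_dnorm_gt0.
  by rewrite fP sqr_sqrtr.
have sym x y : f x y = f y x.
  by rewrite (@hermitian_subproof _ _ _ _ f) expr0 mul1r.
have lin x k y z : f x (k *: y + z) = k * f x y + f x z by rewrite linearPr.
have lin_l y k x z : f (k *: x + z) y = k * f x y + f z y.
  by rewrite sym lin !(sym y).
pose w := s1 - s2; pose c := (f s1 s1 - f s2 s2) / 2.
have hull_sub : convex_hull (range p) `<=` [set z | f z w = c].
  apply: convex_hull_sub.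
    apply/convex_setP => x y t /= fx fy _ _.
    by rewrite lin_l -[_ *: y]addr0 lin_l fx fy linear0l; ring.
  move=> _ [i _ <-] /=.
  have : `|p i - s1| ^+ 2 = `|p i - s2| ^+ 2 by rewrite eqd//; exists i.
  rewrite -!sq.
  have subE x y : f (x - y) (x - y) = f x x - 2 * f x y + f y y.
    have -> : x - y = -1 *: y + x by vec.
    by rewrite lin !lin_l (sym y x); ring.
  have -> : f (p i) w = f (p i) s1 - f (p i) s2.
    have -> : w = -1 *: s2 + s1 by rewrite /w; vec.
    by rewrite lin; ring.
  by rewrite !subE /c; lra.
have ww : f w w = 0.
  rewrite [X in f X _](_ : w = -1 *: s2 + s1); last by rewrite /w; vec.
  by rewrite lin_l (hull_sub _ h1) (hull_sub _ h2); ring.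
apply/eqP; rewrite -subr_eq0 -/w -normr_eq0 -sqrf_eq0 -sq ww//.
Qed.

End NormedSpace.

Theorem theorem3 (R : realType) (d : nat) (X : normedModType R)
    (hd : (3 <= d)%N) (hX : dim_ge X d) :
  SRS d X <-> inner_product_space X.
Proof.
split; last exact: inner_product_SRS.
elim: d hd hX => // d IH; rewrite leq_eqVlt => /orP[/eqP <- dimX srs|].
  apply: left_add_inner_product => //; exact: SRS3_birkhoff_left_additive.
rewrite ltnS => hd dimX srs.
by apply: (IH hd (dim_geS dimX)); exact: SRS_pred.
Qed.
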